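(* Let $\mu$ be a joint distribution of a triple $(X,A,Y)$ with $X\in\mathcal{X}\subseteq\mathbb{R}^d$, $A\in\{0,1\}$ with $\Pr(A=0),\Pr(A=1)>0$, and $Y\in[-1,1]$. Let $h:\mathcal{X}\to\mathbb{R}$ be measurable and $\widehat{Y}=h(X)$. If $\widehat{Y}$ is statistically independent of $A$ (statistical parity), then for every $p\geq 1$, $$\varepsilon_{p,\mu_0}(\widehat{Y})+\varepsilon_{p,\mu_1}(\widehat{Y})\geq W_p(Y_\sharp\mu_0,Y_\sharp\mu_1).$$
   Context: For $a\in\{0,1\}$, $\mu_a$ is the conditional distribution of $(X,Y)$ given $A=a$. For a distribution $\nu$, $\varepsilon_{p,\nu}(\widehat{Y}):=\left(\mathbb{E}_\nu[|\widehat{Y}-Y|^p]\right)^{1/p}$. $Y_\sharp\mu_a$ denotes the distribution of $Y$ under $\mu_a$. $W_p(\nu,\nu')=\left(\inf_{\gamma\in\Gamma(\nu,\nu')}\int|t-t'|^p\,d\gamma(t,t')\right)^{1/p}$ is the $p$-Wasserstein distance, where $\Gamma(\nu,\nu')$ is the set of couplings of $\nu$ and $\nu'$. *)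

(* Defs.v *)
From HB Require Import structures.
From mathcomp Require Import all_boot all_order all_algebra.
From mathcomp Require Import all_classical all_reals all_analysis.
Set Implicit Arguments. Unset Strict Implicit. Unset Printing Implicit Defensive.
Import Order.TTheory GRing.Theory Num.Theory.
Local Open Scope classical_set_scope.
Local Open Scope ring_scope.

(* Setting: a probability space (Omega, P) carrying the random triple
   (X, A, Y).  The joint law mu of (X,A,Y) is the pushforward of P.
   For a in {0,1} (encoded as bool: false = 0, true = 1), mu_a is the law
   of (X,Y) conditionally on the event {A = a}. *)

Section fair_defs.
Context {d : measure_display} {Omega : measurableType d} {R : realType}.
Variable P : probability Omega R.

Definition event_A (A : Omega -> bool) (a : bool) : set Omega :=
  A @^-1` [set a].

Definition cond_expect (A : Omega -> bool) (a : bool) (g : Omega -> \bar R)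
  : \bar R :=
  ((\int[P]_(w in event_A A a) g w) * ((fine (P (event_A A a)))^-1)%:E)%E.

Definition eps_p (p : R) (A : Omega -> bool) (a : bool)
  (Yhat Y : Omega -> R) : \bar R :=
  poweR (cond_expect A a (fun w => (`|Yhat w - Y w| `^ p)%:E)) p^-1.

Definition cond_law (A : Omega -> bool) (a : bool) (Y : Omega -> R)
  (B : set R) : \bar R :=
  (P (event_A A a `&` Y @^-1` B) * ((fine (P (event_A A a)))^-1)%:E)%E.

(* Statistical parity: Yhat is independent of A, i.e.
   P({Yhat in B} /\ {A = a}) = P(Yhat in B) P(A = a)
   for every Borel B and every a (these events generate sigma(A)). *)
Definition stat_indep_RV_bool (Yhat : Omega -> R) (A : Omega -> bool) : Prop :=
  forall (B : set R) (a : bool), measurable B ->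
    P (Yhat @^-1` B `&` event_A A a) = (P (Yhat @^-1` B) * P (event_A A a))%E.

End fair_defs.

Definition coupling {R : realType} (nu nu' : set R -> \bar R) :
  set (probability (R * R)%type R) :=
  [set gamma | forall B : set R, measurable B ->
      gamma (B `*` setT) = nu B /\ gamma (setT `*` B) = nu' B].

Definition Wasserstein {R : realType} (p : R) (nu nu' : set R -> \bar R)
  : \bar R :=
  poweR (ereal_inf [set (\int[gamma]_z (`|z.1 - z.2| `^ p)%:E)%E
                    | gamma in coupling nu nu']) p^-1.

(* Main.v *)
(** Statistical parity says that [h(X)] has the same law under both conditional
    distributions [P(. | A = 0)] and [P(. | A = 1)].  For every [e > 0] these
    two probabilities therefore have a coupling under which the two copies of
    [h(X)] differ by at most [e] almost surely.  The two copies of [Y] then form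
    a coupling of their conditional laws, and Minkowski's inequality along
    [Y_0, h(X_0), h(X_1), Y_1] bounds its cost by [eps_0 + e + eps_1].  Let [e]
    tend to [0]. *)

Require Import Defs.
From HB Require Import structures.
From mathcomp Require Import all_boot all_order all_algebra.
From mathcomp Require Import all_classical all_reals all_analysis.
From mathcomp Require Import measurable_realfun lra.
Import Order.TTheory GRing.Theory Num.Theory.
Local Open Scope classical_set_scope.
Local Open Scope ring_scope.

(** The cells are the half-open intervals from k * e to (k + 1) * e, for k an integer. Naturals
    enumerate them through the countable encoding of [int]; a natural that encodes no integer gets
    the empty cell. *)
Lemma small_diameter_partition (R : realType) (e : R) : 0 < e ->
  exists F : nat -> set R, [/\ forall k, measurable (F k), trivIset setT F,
    \bigcup_k F k = setT &
    forall k x y, F k x -> F k y -> `|x - y| <= e].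
Proof.
move=> e0.
exists (fun n => [set x | Some (Num.floor (x / e)) = pickle_inv n]); split.
- move=> n; case: (pickle_inv n) => [k|]; last first.
    by rewrite [X in measurable X](_ : _ = set0)// -subset0 => x.
  rewrite [X in measurable X](_ : _ =
      `[k%:~R * e, (k + 1)%:~R * e[%classic); first exact: measurable_itv.
  apply/seteqP; split=> x /=; rewrite in_itv/= -ler_pdivlMr// -ltr_pdivrMr//.
    by case=> <-; rewrite floor_itv.
  by move=> xk; congr Some; exact: floor_def.
- move=> m n _ _ [x [/= hm hn]].
  by rewrite -(@pickle_invK int m) -(@pickle_invK int n) -hm -hn.
- rewrite -subTset => x _; exists (pickle (Num.floor (x / e))) => //=.
  by rewrite pickleK_inv.
- move=> n x y /= <- [] xy.
  have := floor_itv (x / e); have := floor_itv (y / e); rewrite xy intrD.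
  move=> /andP[y1 y2] /andP[x1 x2].
  have -> : x - y = (x / e - y / e) * e by rewrite -mulrBl mulfVK ?gt_eqF.
  rewrite normrM (gtr0_norm e0) ler_piMl ?ltW// ltr_norml; lra.
Qed.

Local Open Scope ereal_scope.

Lemma ge0_integral_mrestr d (T : measurableType d) (R : realType)
    (mu : {measure set T -> \bar R}) (D : set T) (mD : measurable D)
    (f : T -> \bar R) :
  measurable_fun setT f -> (forall x, 0 <= f x) ->
  \int[mrestr mu mD]_x f x = \int[mu]_(x in D) f x.
Proof.
move=> mf f0.
rewrite (@ge0_negligible_integral _ _ _ _ setT (~` D))//.
- rewrite setTD setCK; apply: eq_measure_integral => B mB BD.
  by rewrite /= /mrestr (setIidl BD).
- exact: measurableC.
- by rewrite /= /mrestr setICl measure0.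
Qed.

Lemma measurable_preimage d d' (T : measurableType d) (T' : measurableType d')
    (f : T -> T') (B : set T') :
  measurable_fun setT f -> measurable B -> measurable (f @^-1` B).
Proof. by move=> mf mB; rewrite -[f @^-1` B]setTI; exact: mf. Qed.

(** Countable additivity: pulling the partition back along [Z] cuts [B] into disjoint pieces. This
    recovers a marginal from its contributions cell by cell. *)
Lemma sum_measure_preimage_partition d d' (T : measurableType d)
    (T' : measurableType d') (R : realType) (mu : {measure set T -> \bar R})
    (F : nat -> set T') (Z : T -> T') (B : set T) :
  (forall k, measurable (F k)) -> trivIset setT F -> \bigcup_k F k = setT ->
  measurable_fun setT Z -> measurable B ->
  \sum_(0 <= k <oo) mu (B `&` Z @^-1` F k) = mu B.
Proof.
move=> mF tF cF mZ mB.
have mFZ k : measurable (Z @^-1` F k) by exact: measurable_preimage.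
rewrite -measure_semi_bigcup.
- by rewrite -setI_bigcupr -preimage_bigcup cF preimage_setT setIT.
- by move=> k; exact: measurableI.
- by move=> i j _ _ [x [[_ Fi] [_ Fj]]]; apply: (tF i j) => //; exists (Z x).
- by apply: bigcup_measurable => k _; exact: measurableI.
Qed.

(* For [y = 0] both sides vanish, since [0^-1 = 0]. *)
Lemma mul_fineVK (R : realType) (x y : \bar R) :
  0 <= x -> x <= y -> y < +oo -> ((fine y)^-1)%:E * (x * y) = x.
Proof.
case: x y => [x||] [y||]//; rewrite !lee_fin => x0 xy _.
rewrite -!EFinM/=; have [y0|y0] := eqVneq y 0%R.
  by congr EFin; apply/eqP; rewrite y0 invr0 mul0r eq_sym eq_le x0 -y0 xy.
by rewrite mulrC mulfK.
Qed.

(* Exact gluing would need a disintegration of [P1] and [P2] over the common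
   law of [Z1] and [Z2]; up to an error [e] it suffices to take the product of
   [P1] and [P2] conditionally on each cell of a countable partition of mesh
   [e], mixed with the common weights of the cells. *)
Lemma approximate_gluing d1 d2 (T1 : measurableType d1) (T2 : measurableType d2)
    (R : realType) (P1 : probability T1 R) (P2 : probability T2 R)
    (Z1 : T1 -> R) (Z2 : T2 -> R) (e : R) :
  measurable_fun setT Z1 -> measurable_fun setT Z2 ->
  (forall B, measurable B -> P1 (Z1 @^-1` B) = P2 (Z2 @^-1` B)) ->
  (0 < e)%R ->
  exists Q : probability (T1 * T2)%type R,
    [/\ forall B, measurable B -> Q (fst @^-1` B) = P1 B,
        forall B, measurable B -> Q (snd @^-1` B) = P2 B &
        {ae Q, forall z, (`|Z1 z.1 - Z2 z.2| <= e)%R}].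
Proof.
move=> mZ1 mZ2 Z12 e0.
have [F [mF tF cF dF]] := small_diameter_partition _ _ e0.
have mF1 k : measurable (Z1 @^-1` F k) by exact: measurable_preimage.
have mF2 k : measurable (Z2 @^-1` F k) by exact: measurable_preimage.
have c0 k : (0 <= (fine (P1 (Z1 @^-1` F k)))^-1)%R.
  by rewrite invr_ge0 fine_ge0.
(* Let c be the mass of [F k] under the common law of [Z1] and [Z2]. The restricted product has mass
   c^2, and the weight 1/c brings it to c; a cell of mass 0 gets weight 0 since [0^-1 = 0]. *)
pose Q : {measure set (T1 * T2) -> \bar R} :=
  mseries (fun k => mscale (NngNum (c0 k))
    (mrestr (P1 \x P2) (measurableX (mF1 k) (mF2 k)))) 0.
have Q1 B : measurable B -> Q (fst @^-1` B) = P1 B.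
  move=> mB; rewrite -[RHS](sum_measure_preimage_partition _ _ _ _ _ _ F Z1)//.
  apply: eq_eseriesr => k _.
  rewrite /= /mscale /= /mrestr.
  rewrite (_ : _ `&` _ = (B `&` Z1 @^-1` F k) `*` (Z2 @^-1` F k)); last first.
    by apply/seteqP; split=> -[x y]/=; tauto.
  rewrite product_measure1E//; last exact: measurableI.
  (* Equality of the laws turns the [P2] factor into the very mass by which the weight divides. *)
  rewrite -[X in _ * (_ * X)]/(P2 (Z2 @^-1` F k)) -Z12// mul_fineVK//.
  - by rewrite le_measure ?inE//; exact: measurableI.
  - by rewrite -ge0_fin_numE// fin_num_measure.
have Q2 B : measurable B -> Q (snd @^-1` B) = P2 B.
  move=> mB; rewrite -[RHS](sum_measure_preimage_partition _ _ _ _ _ _ F Z2)//.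
  apply: eq_eseriesr => k _.
  rewrite /= /mscale /= /mrestr.
  rewrite (_ : _ `&` _ = (Z1 @^-1` F k) `*` (B `&` Z2 @^-1` F k)); last first.
    by apply/seteqP; split=> -[x y]/=; tauto.
  rewrite product_measure1E//; last exact: measurableI.
  rewrite -[X in _ * (X * _)]/(P1 (Z1 @^-1` F k)).
  rewrite Z12// [X in _ * X]muleC mul_fineVK//.
  - by rewrite le_measure ?inE//; exact: measurableI.
  - by rewrite -ge0_fin_numE// fin_num_measure.
have QT : Q setT = 1 by rewrite -(preimage_setT fst) Q1// probability_setT.
(* [Q] already has mass 1, so normalizing changes no value and only supplies the structure of a
   probability; [P1 \x P2] is the fallback for a degenerate mass. *)
pose PQ : probability (T1 * T2)%type R := mnormalize Q (P1 \x P2).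
have PQE B : PQ B = Q B.
  by rewrite /= /mnormalize /= QT/= onee_eq0/= invr1 mule1.
exists PQ; split => [B mB|B mB|]; [by rewrite PQE Q1|by rewrite PQE Q2|].
exists (~` [set z | (`|Z1 z.1 - Z2 z.2| <= e)%R]); split => //.
- apply: measurableC; rewrite -[X in measurable X]setTI.
  apply: (measurable_fun_ler (f := fun z => `|Z1 z.1 - Z2 z.2|%R)
    (g := cst e)) => //.
  apply: measurableT_comp => //.
  by apply: measurable_funB; exact: measurableT_comp.
(* The k-th summand lives where [Z1] and [Z2] both fall in [F k], a cell of diameter at most [e], so
   it does not charge the exceptional set. *)
- rewrite PQE /Q /mseries; apply: eseries0 => k _ _.
  rewrite /= /mscale /= /mrestr (_ : _ `&` _ = set0) ?measure0 ?mule0//.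
  rewrite -subset0 => -[x y]/= [h [Fx Fy]]; apply: h.
  exact: dF Fx Fy.
Qed.

Lemma measurable_norm_poweR d (T : measurableType d) (R : realType)
    (f : T -> R) (p : R) : measurable_fun setT f ->
  measurable_fun setT (fun x => `|(f x)%:E| `^ p).
Proof.
move=> mf; apply: (measurableT_comp (f := poweR^~ p)).
  exact: measurable_poweR.
by apply: measurableT_comp => //; exact/measurable_EFinP.
Qed.

(** Change of variables along [pi]. With [fst] and [snd] it reduces a norm under a coupling to a
    norm under one of its marginals. *)
Lemma Lnorm_marginal d d' (T : measurableType d) (T' : measurableType d')
    (R : realType) (Q : {measure set T -> \bar R})
    (P : {measure set T' -> \bar R}) (pi : T -> T') (f : T' -> R) (p : R) :
  measurable_fun setT pi -> measurable_fun setT f ->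
  (forall B, measurable B -> Q (pi @^-1` B) = P B) ->
  Lnorm Q p%:E (EFin \o (f \o pi)) = Lnorm P p%:E (EFin \o f).
Proof.
move=> mpi mf QP; rewrite unlock; congr (_ `^ _).
rewrite -[RHS](@eq_measure_integral _ _ _ _ _ (pushforward Q pi)); last first.
  by move=> B mB _; rewrite -QP.
rewrite [RHS]ge0_integral_pushforward//.
- exact: measurable_norm_poweR.
- by move=> *; exact: poweR_ge0.
Qed.

Lemma Lnorm_ae_le d (T : measurableType d) (R : realType)
    (Q : probability T R) (f : T -> R) (p e : R) :
  measurable_fun setT f -> (0 < p)%R -> (0 <= e)%R ->
  {ae Q, forall z, (`|f z| <= e)%R} -> Lnorm Q p%:E (EFin \o f) <= e%:E.
Proof.
move=> mf p0 e0 fe; rewrite unlock.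
have -> : e%:E = (e%:E `^ p) `^ p^-1.
  by rewrite -poweRrM mulfV ?gt_eqF// poweRe1.
apply: gt0_ler_poweR; first by rewrite invr_ge0 ltW.
- by rewrite in_itv/= leey integral_ge0// => *; exact: poweR_ge0.
- by rewrite in_itv/= leey lee_fin powR_ge0.
(* The total mass 1 of [Q] turns the constant into an integral, so an almost everywhere comparison
   of integrands suffices. *)
rewrite -[leRHS]mule1 -(probability_setT Q) -integral_cst//.
apply: ae_ge0_le_integral => //.
- by move=> *; exact: poweR_ge0.
- exact: measurable_norm_poweR.
- by move=> *; exact: poweR_ge0.
- apply: filterS fe => z fz _.
  by apply: gt0_ler_poweR; rewrite ?in_itv/= ?leey ?andbT ?lee_fin// ltW.
Qed.

Lemma Wasserstein_le_common_law d1 d2 (T1 : measurableType d1)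
    (T2 : measurableType d2) (R : realType)
    (P1 : probability T1 R) (P2 : probability T2 R)
    (Y1 Z1 : T1 -> R) (Y2 Z2 : T2 -> R) (p : R) :
  measurable_fun setT Y1 -> measurable_fun setT Y2 ->
  measurable_fun setT Z1 -> measurable_fun setT Z2 ->
  (forall B, measurable B -> P1 (Z1 @^-1` B) = P2 (Z2 @^-1` B)) ->
  (1 <= p)%R ->
  Wasserstein p (pushforward P1 Y1) (pushforward P2 Y2) <=
    Lnorm P1 p%:E (EFin \o (Y1 \- Z1)%R) + Lnorm P2 p%:E (EFin \o (Z2 \- Y2)%R).
Proof.
move=> mY1 mY2 mZ1 mZ2 Z12 p1.
have p0 : (0 < p)%R by exact: lt_le_trans p1.
apply/lee_addgt0Pr => e e0.
have [Q [Q1 Q2 Qe]] := approximate_gluing _ _ _ _ _ P1 P2 _ _ _ mZ1 mZ2 Z12 e0.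
(* The increments [f1], [g], [f2] telescope to the difference of the two copies of [Y]; only [g]
   involves both coordinates. *)
pose f1 : T1 * T2 -> R := (Y1 \- Z1)%R \o fst.
pose f2 : T1 * T2 -> R := (Z2 \- Y2)%R \o snd.
pose g : T1 * T2 -> R := fun z => (Z1 z.1 - Z2 z.2)%R.
have mf1 : measurable_fun setT f1.
  by apply: measurableT_comp => //; exact: measurable_funB.
have mf2 : measurable_fun setT f2.
  by apply: measurableT_comp => //; exact: measurable_funB.
have mg : measurable_fun setT g.
  by apply: measurable_funB; exact: measurableT_comp.
pose YY := fun z : T1 * T2 => (Y1 z.1, Y2 z.2).
have mYY : measurable_fun setT YY.
  by apply: measurable_fun_pair; exact: measurableT_comp.
pose G : probability (R * R)%type R := distribution Q (mfun_Sub (mem_set mYY)).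
have GC : coupling (pushforward P1 Y1) (pushforward P2 Y2) G.
  move=> B mB; split.
  - rewrite /pushforward -Q1; last exact: measurable_preimage.
    by congr (Q _); apply/seteqP; split => [z []|z Bz] //; split.
  - rewrite /pushforward -Q2; last exact: measurable_preimage.
    by congr (Q _); apply/seteqP; split => [z []|z Bz] //; split.
have costE : \int[G]_z (`|z.1 - z.2| `^ p)%:E =
    \int[Q]_z `|((f1 \+ g \+ f2) z)%:E| `^ p.
  rewrite ge0_integral_pushforward//.
  - apply: eq_integral => z _ /=; rewrite /f1 /g /f2 /=.
    by congr (`|_| `^ _)%:E; rewrite !addrA !subrK.
  - apply/measurable_EFinP.
    apply: (measurableT_comp (measurable_powR p)).
    by apply: measurableT_comp => //; exact: measurable_funB.
(* The infimum is at most the cost of the particular coupling [G], which [costE] expresses under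
   [Q]. *)
apply: (@le_trans _ _ (Lnorm Q p%:E (EFin \o (f1 \+ g \+ f2)%R))).
  rewrite unlock -costE; apply: gt0_ler_poweR; first by rewrite invr_ge0 ltW.
  - rewrite in_itv/= leey andbT; apply: le_ereal_inf_tmp => _ [G' _ <-].
    by apply: integral_ge0 => z _; rewrite lee_fin powR_ge0.
  - rewrite in_itv/= leey andbT.
    by apply: integral_ge0 => z _; rewrite lee_fin powR_ge0.
  - apply: ge_ereal_inf; exists (\int[G]_z (`|z.1 - z.2| `^ p)%:E) => //.
    by exists G.
apply: (le_trans (minkowski_EFin Q _ mf2 p1)); first exact: measurable_funD.
rewrite addeAC -(Lnorm_marginal _ _ _ _ _ Q P1 fst)//; last first.
  exact: measurable_funB.
rewrite -(Lnorm_marginal _ _ _ _ _ Q P2 snd)//; last exact: measurable_funB.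
apply: leeD => //; apply: (le_trans (minkowski_EFin Q mf1 mg p1)).
by apply: leeD => //; apply: Lnorm_ae_le => //; exact: ltW.
Qed.

Section conditioning.
Context d (Omega : measurableType d) (R : realType) (P : probability Omega R).
Variables (D : set Omega) (mD : measurable D).

(** The second argument [P] is the value taken when [D] is null, which makes this a probability for
    every measurable [D]; [PD0] excludes that case below. *)
Definition cond_prob : probability Omega R := mnormalize (mrestr P mD) P.

Hypothesis PD0 : 0 < P D.

Lemma cond_probE B : cond_prob B = P (B `&` D) * ((fine (P D))^-1)%:E.
Proof.
rewrite /= /mnormalize /= /mrestr setTI gt_eqF//= ifF//.
by apply/negbTE; rewrite -ltey (le_lt_trans (probability_le1 P mD)) ?ltry.
Qed.

Lemma ge0_integral_cond_prob (f : Omega -> \bar R) :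
  measurable_fun setT f -> (forall x, 0 <= f x) ->
  \int[cond_prob]_x f x = (\int[P]_(x in D) f x) * ((fine (P D))^-1)%:E.
Proof.
move=> mf f0.
have c0 : (0 <= (fine (P D))^-1)%R by rewrite invr_ge0 fine_ge0.
rewrite (@eq_measure_integral _ _ _ _ (mscale (NngNum c0) (mrestr P mD))).
  by rewrite ge0_integral_mscale// ge0_integral_mrestr// muleC.
by move=> B mB _; apply: (etrans (cond_probE B)); rewrite muleC.
Qed.

End conditioning.

Local Close Scope ereal_scope.

Theorem theorem1 (d : measure_display) (Omega : measurableType d)
  (R : realType) (P : probability Omega R)
  (dX : measure_display) (TX : measurableType dX)
  (X : Omega -> TX) (A : Omega -> bool) (Y : Omega -> R) (h : TX -> R)
  (mX : measurable_fun setT X) (mA : measurable_fun setT A)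
  (mY : measurable_fun setT Y) (mh : measurable_fun setT h)
  (PA0 : (0 < P (event_A A false))%E) (PA1 : (0 < P (event_A A true))%E)
  (Ybound : forall w, -1 <= Y w <= 1)
  (parity : stat_indep_RV_bool P (h \o X) A)
  (p : R) (p1 : 1 <= p) :
  (eps_p P p A false (h \o X) Y + eps_p P p A true (h \o X) Y
   >= Wasserstein p (cond_law P A false Y) (cond_law P A true Y))%E.
Proof.
have mAa a : measurable (event_A A a).
  exact: measurable_preimage.
have PA a : (0 < P (event_A A a))%E by case: a.
have mZ : measurable_fun setT (h \o X) by exact: measurableT_comp.
pose Pa a := cond_prob _ _ _ P _ (mAa a).
have lawE a : cond_law P A a Y = pushforward (Pa a) Y.
  by apply/funext => B; rewrite /pushforward cond_probE// setIC.
have epsE a : eps_p P p A a (h \o X) Y =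
    Lnorm (Pa a) p%:E (EFin \o (h \o X \- Y)).
  rewrite unlock ge0_integral_cond_prob//.
  - by apply: measurable_norm_poweR; exact: measurable_funB.
  - by move=> x; exact: poweR_ge0.
(* Parity factors the joint probability and the mass of the event cancels; the right side does not
   depend on [a], so the two conditional laws of the prediction agree. *)
have lawZ a B : measurable B -> Pa a ((h \o X) @^-1` B) = P ((h \o X) @^-1` B).
  move=> mB; rewrite cond_probE// parity// -muleA.
  rewrite -[X in (_ * (X * _))%E]fineK ?fin_num_measure//.
  rewrite -EFinM mulfV ?mule1// gt_eqF// fine_gt0// PA.
  by rewrite -ge0_fin_numE// fin_num_measure.
rewrite !lawE !epsE.
(* The chain of increments starts at [Y], so the first error enters with the opposite sign. *)
have -> : Lnorm (Pa false) p%:E (EFin \o (h \o X \- Y)) =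
    Lnorm (Pa false) p%:E (EFin \o (Y \- (h \o X))).
  rewrite -oppe_Lnorm; apply: eq_Lnorm => x.
  by rewrite /= opprB.
by apply: Wasserstein_le_common_law => // B mB; rewrite !lawZ.
Qed.
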